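(* Let $D$ be any dataset and $D'$ any dataset adjacent to $D$, let $g$ be a data transformer with values in $\mathbb{Z}^r$, let $\beta>0$, and let $\eta\in\mathbb{R}^r$ be any fixed noise perturbation vector. Suppose that the $\beta$-smooth sensitivity of $g$ at $D$ is $\Delta^{S,\beta}g(D)=1\cdot e^{-\beta}$ and that $g$ is a distance-$3$ data transformer at $D$. Then the noisy argmax of both $g(D)$ and $g(D')$ is immutable and the same once a sufficiently large constant is added to the current largest count. That is, there exists $C>0$ such that for every $c\ge C$, $$\arg\max\bigl(g(D)+c\,e_{j(D)}+\eta\bigr)=\arg\max g(D)=\arg\max g(D')=\arg\max\bigl(g(D')+c\,e_{j(D')}+\eta\bigr),$$ where $j(D)$ and $j(D')$ denote the indices of the largest counts of $g(D)$ and $g(D')$ respectively, and $e_i$ is the $i$-th standard basis vector of $\mathbb{R}^r$.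
   Context: Datasets are collections of items; $d(D,D')$ is the number of items in which $D$ and $D'$ differ, and $D,D'$ are adjacent (neighbouring) if $d(D,D')=1$. A data transformer is a function $g$ that maps each dataset $D$ to an integer vector (a vector of counts) $g(D)\in\mathbb{Z}^r$, with $r\ge 2$ the dimension of the vector. For a number $n$, $g$ is a distance-$n$ data transformer at $D$ (also phrased ''$g(D)$ is distance-$n$'') if the difference between the first and second largest counts of $g(D)$ is larger than $n$. The local sensitivity of $g$ at a dataset $D$ is $\Delta^L g(D)=\max_{D':\,d(D,D')=1}\|g(D)-g(D')\|_1$. For $\beta>0$, the $\beta$-smooth sensitivity of $g$ at $D$ is $$\Delta^{S,\beta}g(D)=\max_{D':\,d(D,D')=1}\bigl(\Delta^L g(D')\cdot e^{-\beta\, d(D,D')}\bigr).$$ $\arg\max v$ denotes the index of the largest entry of a vector $v$. The noisy argmax of a count vector, for a given noise vector, is the argmax of the count vector plus the noise vector. Immutable means that the argmax is unaffected by the noise added. *)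

(* Defs.v *)
From mathcomp Require Import all_boot all_order all_algebra finmap multiset.
From mathcomp Require Import all_classical all_reals all_analysis.
Set Implicit Arguments.
Unset Strict Implicit.
Unset Printing Implicit Defensive.
Import Order.TTheory GRing.Theory Num.Theory.
Local Open Scope ring_scope.

(* A dataset is a collection of items; whether a collection is a set, a
   multiset, or a list of fixed length is a parameter. *)
Variant collection := SetOf | MultisetOf | TupleOf of nat.

Definition dataset (k : collection) (X : choiceType) : Type :=
  match k with
  | SetOf => {fset X}%fset
  | MultisetOf => {mset X}%mset
  | TupleOf m => m.-tuple X
  end.

(* The number of items in which two datasets differ: the size of the symmetric
   difference (counted with multiplicity) for sets and multisets, the Hamming
   distance for tuples. *)
Definition dist (k : collection) (X : choiceType) :
    dataset k X -> dataset k X -> nat :=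
  match k return dataset k X -> dataset k X -> nat with
  | SetOf => fun A B => (#|` (A `\` B)%fset| + #|` (B `\` A)%fset|)%N
  | MultisetOf => fun A B => (size (A `\` B)%mset + size (B `\` A)%mset)%N
  | TupleOf m => fun s t => #|[pred i : 'I_m | tnth s i != tnth t i]|
  end.

Definition neighbouring (k : collection) (X : choiceType)
    (D D' : dataset k X) : Prop :=
  dist D D' = 1%N.

(* The counts in decreasing order, with multiplicity: tied largest counts have
   gap 0. *)
Definition sorted_counts (r : nat) (v : 'rV[int]_r) : seq int :=
  sort >=%O [seq v 0 i | i <- enum 'I_r].

Definition distance_at (k : collection) (X : choiceType) (r : nat)
    (n : int) (g : dataset k X -> 'rV[int]_r) (D : dataset k X) : Prop :=
  n < (sorted_counts (g D))`_0 - (sorted_counts (g D))`_1.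

Definition norm1 (r : nat) (v : 'rV[int]_r) : int := \sum_(i < r) `|v 0 i|.

(* The maxima defining the sensitivities are suprema in the extended reals: the
   values are natural numbers (for [smooth_sensitivity], times expR (- beta)),
   so a finite supremum is attained, and +oo means that there is no maximum. *)
Definition local_sensitivity (R : realType) (k : collection) (X : choiceType)
    (r : nat) (g : dataset k X -> 'rV[int]_r) (D : dataset k X) : \bar R :=
  ereal_sup [set ((norm1 (g D - g D'))%:~R : R)%:E
            | D' in [set D' | neighbouring D D']]%classic.

Definition smooth_sensitivity (R : realType) (k : collection) (X : choiceType)
    (r : nat) (beta : R) (g : dataset k X -> 'rV[int]_r) (D : dataset k X) :
    \bar R :=
  ereal_sup [set (local_sensitivity R g D'
                  * (expR (- beta * (dist D D')%:R))%:E)%E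
            | D' in [set D' | neighbouring D D']]%classic.

(* The set of indices of largest entries, so that [argmax v = [set j]] says
   that j is the index of the largest entry of v. *)
Definition argmax (disp : Order.disp_t) (K : orderType disp) (r : nat)
    (v : 'rV[K]_r) : {set 'I_r} :=
  [set i | [forall j, (v 0%R j <= v 0%R i)%O]]%SET.

Definition real_counts (R : realType) (r : nat) (v : 'rV[int]_r) : 'rV[R]_r :=
  map_mx intr v.

(* Main.v *)
(** Since [D] is itself a neighbour of [D'], the smooth sensitivity at [D]
    bounds the local sensitivity at [D'], hence [norm1 (g D - g D')], by 1.
    Each count therefore moves by at most 1, and a gap above 3 leaves the
    largest count in place. Boosting it by [sum_i |eta_i - eta_j|] or more
    absorbs the noise. *)
Require Import Defs.
From mathcomp Require Import all_boot all_order all_algebra.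
From mathcomp Require Import all_classical all_reals all_analysis.
From mathcomp Require Import lra zify.
Import Order.TTheory GRing.Theory Num.Theory.
Local Open Scope ring_scope.

Lemma dist_sym (k : collection) (X : choiceType) (A B : dataset k X) :
  dist A B = dist B A.
Proof.
case: k A B => [A B|A B|m A B] /=; try exact: addnC.
by apply: eq_card => i; rewrite !inE eq_sym.
Qed.

Lemma neighbouring_sym (k : collection) (X : choiceType) (A B : dataset k X) :
  neighbouring A B -> neighbouring B A.
Proof. by rewrite /neighbouring dist_sym. Qed.

Lemma le_norm1 (r : nat) (v : 'rV[int]_r) (i : 'I_r) : `|v 0 i| <= norm1 v.
Proof.
by rewrite /norm1 (bigD1 i) //= lerDl; apply: sumr_ge0 => j _; rewrite normr_ge0.
Qed.

Lemma norm1_le_local_sensitivity (R : realType) (k : collection)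
    (X : choiceType) (r : nat) (g : dataset k X -> 'rV[int]_r)
    (D D' : dataset k X) :
  neighbouring D D' ->
  (((norm1 (g D - g D'))%:~R : R)%:E <= local_sensitivity R g D)%E.
Proof. by move=> DD'; apply: ereal_sup_ubound; exists D'. Qed.

Lemma local_sensitivity_le_smooth (R : realType) (k : collection)
    (X : choiceType) (r : nat) (beta : R) (g : dataset k X -> 'rV[int]_r)
    (D D' : dataset k X) :
  neighbouring D D' ->
  (local_sensitivity R g D' * (expR (- beta))%:E
     <= smooth_sensitivity beta g D)%E.
Proof.
move=> DD'; apply: ereal_sup_ubound; exists D' => //=.
by rewrite (DD' : dist D D' = 1%N) mulr1.
Qed.

(** The common factor [expR (- beta)] is the weight at distance 1. Being finite and positive, it can
    be cancelled in the extended reals without first knowing that the local sensitivity is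
    finite. *)
Lemma norm1_le_of_smooth_sensitivity (R : realType) (k : collection)
    (X : choiceType) (r : nat) (beta : R) (n : int)
    (g : dataset k X -> 'rV[int]_r) (D D' : dataset k X) :
  neighbouring D D' ->
  (smooth_sensitivity beta g D <= (n%:~R * expR (- beta))%:E)%E ->
  norm1 (g D - g D') <= n.
Proof.
move=> DD' smooth_le.
have e_gt0 : (0 < (expR (- beta))%:E)%E by rewrite lte_fin expR_gt0.
have := le_trans (local_sensitivity_le_smooth _ _ _ _ beta g _ _ DD') smooth_le.
rewrite EFinM lee_pmul2r //.
have D'D := neighbouring_sym _ _ _ _ DD'.
move/(le_trans (norm1_le_local_sensitivity R _ _ _ g _ _ D'D)).
rewrite lee_fin ler_int; congr (_ <= _).
by apply: eq_bigr => i _; rewrite !mxE distrC.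
Qed.

(** Turns the gap, which only speaks of sorted values, into a bound between entries. Every index
    other than the one in front sits at position 1 or later, so its count is at most the second
    largest; this covers ties as well. *)
Lemma sorted_counts_gap (r : nat) (v : 'rV[int]_r) :
  (2 <= r)%N ->
  exists j, forall i, i != j ->
    (sorted_counts v)`_0 - (sorted_counts v)`_1 <= v 0 j - v 0 i.
Proof.
move=> r2; pose f i := v 0 i; pose j0 := Ordinal (ltnW r2).
(* Sorting the indices by their counts, instead of the counts, remembers which index each sorted
   count comes from. *)
pose e := sort (relpre f >=%O) (enum 'I_r).
have sE : sorted_counts v = map f e by rewrite /sorted_counts sort_map.
have sze : size e = r by rewrite size_sort size_enum_ord.
have s_sorted : sorted >=%O (map f e).
  by rewrite -sE; apply: sort_sorted => x y; exact: le_total.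
exists (nth j0 e 0) => i ij.
have ie : i \in e by rewrite mem_sort mem_enum.
have lt_i : (index i e < size e)%N by rewrite index_mem.
have i_gt0 : (0 < index i e)%N.
  rewrite lt0n; apply: contra ij => /eqP i0.
  by rewrite -i0 nth_index.
have e_gt0 : (0 < size e)%N by rewrite sze ltnW.
have mono : (map f e)`_(index i e) <= (map f e)`_1.
  apply: (sorted_leq_nth ge_trans ge_refl 0 s_sorted) => //.
    (* By [2 <= r], position 1 holds a genuine count and not the default 0. *)
    by rewrite inE size_map sze.
  by rewrite inE size_map.
rewrite (nth_map j0 0 f lt_i) nth_index // in mono.
have top : (map f e)`_0 = v 0 (nth j0 e 0) := nth_map j0 0 f e_gt0.
by rewrite sE top lerD2l lerN2.
Qed.

Lemma argmax_set1 (disp : Order.disp_t) (K : orderType disp) (r : nat)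
    (v : 'rV[K]_r) (j : 'I_r) :
  (forall i, i != j -> (v 0%R i < v 0%R j)%O) -> argmax v = [set j]%SET.
Proof.
move=> jmax; apply/setP => i; rewrite !inE.
have [->|ij] := eqVneq i j.
  by apply/forallP => l; have [->//|/jmax/ltW] := eqVneq l j.
by apply/negbTE/negP => /forallP/(_ j); rewrite leNgt jmax.
Qed.

(** The strict inequality comes from the counts themselves, so [c] need only match the noise
    differences weakly. *)
Lemma argmax_boosted (R : realType) (r : nat) (v : 'rV[int]_r)
    (eta : 'rV[R]_r) (j : 'I_r) (c : R) :
  (forall i, i != j -> v 0 i < v 0 j) ->
  (forall i, eta 0 i - eta 0 j <= c) ->
  argmax (real_counts R v + c *: delta_mx 0 j + eta) = [set j]%SET.
Proof.
move=> jmax c_ge; apply: argmax_set1 => i ij.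
rewrite !mxE !eqxx (negbTE ij) /= mulr0 mulr1.
have : (v 0 i)%:~R < (v 0 j)%:~R :> R by rewrite ltr_int jmax.
have := c_ge i; lra.
Qed.

Theorem theorem3 (R : realType) (k : collection) (X : choiceType) (r : nat)
    (g : dataset k X -> 'rV[int]_r) (D D' : dataset k X)
    (beta : R) (eta : 'rV[R]_r) :
  (2 <= r)%N ->
  0 < beta ->
  neighbouring D D' ->
  smooth_sensitivity beta g D = (1 * expR (- beta))%:E ->
  distance_at 3 g D ->
  exists j j' : 'I_r,
    [/\ argmax (g D) = [set j]%SET,
        argmax (g D') = [set j']%SET &
        exists2 C : R, 0 < C & forall c : R, C <= c ->
          [/\ argmax (real_counts R (g D) + c *: delta_mx 0 j + eta)
                = argmax (g D),
              argmax (g D) = argmax (g D') &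
              argmax (g D')
                = argmax (real_counts R (g D') + c *: delta_mx 0 j' + eta)]].
Proof.
move=> r2 _ DD' smoothE gap3.
have [j jgap] := sorted_counts_gap _ (g D) r2.
have jfar i : i != j -> 3 < g D 0 j - g D 0 i.
  by move=> ij; apply: lt_le_trans gap3 (jgap i ij).
have close i : `|g D 0 i - g D' 0 i| <= 1.
  have := norm1_le_of_smooth_sensitivity R k X r beta 1 g D D' DD'.
  rewrite smoothE => /(_ (lexx _)); apply: le_trans.
  by have := le_norm1 _ (g D - g D') i; rewrite !mxE.
have jD i : i != j -> g D 0 i < g D 0 j by move=> /jfar; lia.
have jD' i : i != j -> g D' 0 i < g D' 0 j.
  (* The entries at [i] and [j] each move by at most 1, so the gap shrinks by at most 2 and stays
     positive. *)
  by move=> /jfar; have := close i; have := close j; lia.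
have argD := argmax_set1 _ _ _ _ _ jD.
have argD' := argmax_set1 _ _ _ _ _ jD'.
exists j, j; split=> //.
(* The sum dominates all noise differences at once; the added 1 keeps the constant positive even
   when all entries of [eta] agree. As [j] is the top index for both datasets, one constant serves
   both. *)
exists (1 + \sum_i `|eta 0 i - eta 0 j|).
  by rewrite ltr_pwDl // sumr_ge0.
move=> c c_ge.
have c_bound i : eta 0 i - eta 0 j <= c.
  apply: le_trans (ler_norm _) (le_trans _ c_ge).
  rewrite (bigD1 i) //= addrCA lerDl addr_ge0 //.
  by rewrite sumr_ge0.
by rewrite argD argD' !argmax_boosted.
Qed.
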